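(* Assume (A1) and (A2). In case that $H(t,\cdot)$ is a concave function, assume in addition that $H(t,\cdot)$ is strictly concave for a.e. $t\in(0,T)$. Let $(t_0,x_0)\in\Omega$, let $p_0=\sigma_y(y)\in\ell(t_0,x_0)$ with $y\in\ell^*(t_0,x_0)$, and let $$\mathcal C:\ x=x_0+\int_{t_0}^tH_p(\tau,p_0)\,d\tau$$ be the corresponding characteristic curve of type (I) at $(t_0,x_0)$. Then $\ell(t,x)=\{p_0\}$ for all $(t,x)\in\mathcal C$ with $0\le t<t_0$.
   Context: Let $T>0$ and $\Omega=(0,T)\times\mathbb R^n$. Let $H=H(t,p)$ be a real-valued function of class $C^1$ on $[0,T]\times\mathbb R^n$ and $\sigma:\mathbb R^n\to\mathbb R$ be convex and of class $C^1$. $\sigma^*:\mathbb R^n\to\mathbb R\cup\{+\infty\}$ is the Fenchel conjugate of $\sigma$; $H_p$ is the gradient of $H$ in $p$ and $\sigma_y$ the gradient of $\sigma$. Condition (A1): for every $(t_0,x_0)\in[0,T)\times\mathbb R^n$ there exist positive constants $r$ and $N$ such that $$\langle x,p\rangle-\sigma^*(p)-\int_0^tH(\tau,p)\,d\tau<\max_{|q|\le N}\Big\{\langle x,q\rangle-\sigma^*(q)-\int_0^tH(\tau,q)\,d\tau\Big\}$$ whenever $(t,x)\in[0,T)\times\mathbb R^n$, $|t-t_0|+|x-x_0|<r$ and $|p|>N$. Condition (A2): $H$ has one of the two following forms: a) $H(t,\cdot)$ is convex for all $t\in(0,T)$, or $H(t,\cdot)$ is concave for all $t\in(0,T)$; b)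 $H(t,p)=g(t)h(p)+k(t)$ for some functions $g,h,k$, where $g(t)$ does not change its sign on $(0,T)$. For $(t,x)\in[0,T)\times\mathbb R^n$, $\ell(t,x)$ is the set of all $p\in\mathbb R^n$ at which the function $q\mapsto\langle x,q\rangle-\sigma^*(q)-\int_0^tH(\tau,q)\,d\tau$ attains its maximum over $\mathbb R^n$. For $y\in\mathbb R^n$, the characteristic curve emanating from $(0,y)$ is $x=y+\int_0^tH_p(\tau,\sigma_y(y))\,d\tau$, $t\in[0,T]$. For $(t_0,x_0)\in\Omega$, $\ell^*(t_0,x_0)$ is the set of all $y$ such that the characteristic curve emanating from $(0,y)$ passes through $(t_0,x_0)$; this curve can then be written $x=x_0+\int_{t_0}^tH_p(\tau,\sigma_y(y))\,d\tau$, $t\in[0,T]$. Such a characteristic curve (with $y\in\ell^*(t_0,x_0)$) is of type (I) at $(t_0,x_0)$ if $\sigma_y(y)\in\ell(t_0,x_0)$. ''$(t,x)\in\mathcal C$'' means $x$ is the value of the curve at time $t$.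
   Formalization: In (A2)b, ''g does not change its sign on (0,T)'' is taken as g>0 throughout, g<0 throughout, or g=0 throughout; if g is only ≥0 or ≤0 and may vanish on an interval, the claim is false. *)

(* Defs.v *)
From HB Require Import structures.
From mathcomp Require Export all_boot all_order all_algebra.
From mathcomp Require Export all_classical all_reals all_analysis.

Set Implicit Arguments.
Unset Strict Implicit.
Unset Printing Implicit Defensive.

Import Order.TTheory GRing.Theory Num.Theory.
Import numFieldNormedType.Exports.

Local Open Scope classical_set_scope.
Local Open Scope ring_scope.

(* R^n is 'rV[R]_n. The library norm on 'rV[R]_n is the sup norm, hence the
   separate Euclidean norm [enorm]. *)
Definition dot (R : realType) (n : nat) (x y : 'rV[R]_n) : R :=
  \sum_(i < n) x 0 i * y 0 i.

Definition enorm (R : realType) (n : nat) (x : 'rV[R]_n) : R :=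
  Num.sqrt (dot x x).

Definition gradient (R : realType) (n : nat) (f : 'rV[R]_n -> R)
    (x : 'rV[R]_n) : 'rV[R]_n :=
  \row_(i < n) 'D_(delta_mx 0 i) f x.

Definition C1 (R : realType) (n : nat) (f : 'rV[R]_n -> R) : Prop :=
  (forall x, differentiable f x) /\ continuous (gradient f).

(* [H] takes arguments outside [0, T] as well, but only its values on
   [0, T] x R^n matter: the derivative in [t] is taken relative to [0, T], so
   it is one-sided at t = 0 and t = T. *)
Definition C1_strip (R : realType) (n : nat) (T : R)
    (H : R -> 'rV[R]_n -> R) : Prop :=
  let strip : set (R * 'rV[R]_n) := [set z | 0 <= z.1 <= T] in
  [/\ {within strip, continuous (fun z : R * 'rV[R]_n => H z.1 z.2)},
      exists Ht : R -> 'rV[R]_n -> R,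
        (forall (t : R) (p : 'rV[R]_n), 0 <= t <= T ->
          (s - t)^-1 * (H s p - H t p) @[s --> within `[0, T] t^'] --> Ht t p)
        /\ {within strip, continuous (fun z : R * 'rV[R]_n => Ht z.1 z.2)},
      forall (t : R) (p : 'rV[R]_n), 0 <= t <= T ->
        differentiable (H t) p &
      {within strip, continuous
        (fun z : R * 'rV[R]_n => gradient (H z.1) z.2)}].

Definition convex_fun (R : realType) (n : nat) (f : 'rV[R]_n -> R) : Prop :=
  convex_function [set: convex_lmodType 'rV[R]_n] f.

Definition concave_fun (R : realType) (n : nat) (f : 'rV[R]_n -> R) : Prop :=
  convex_fun (fun x => - f x).

Definition strictly_concave_fun (R : realType) (n : nat)
    (f : 'rV[R]_n -> R) : Prop :=
  forall (x y : 'rV[R]_n) (a : R), x != y -> 0 < a < 1 ->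
    a * f x + (1 - a) * f y < f (a *: x + (1 - a) *: y).

Definition fenchel (R : realType) (n : nat) (f : 'rV[R]_n -> R)
    (p : 'rV[R]_n) : \bar R :=
  ereal_sup [set (dot y p - f y)%:E | y in [set: 'rV[R]_n]].

(* Integral from [a] to [b], with the sign convention
   $\int_a^b = - \int_b^a$ when b < a. *)
Definition oint (R : realType) (a b : R) (f : R -> R) : R :=
  if a <= b then \int[lebesgue_measure]_(s in `[a, b]) f s
  else - \int[lebesgue_measure]_(s in `[b, a]) f s.

Definition oint_vec (R : realType) (n : nat) (a b : R)
    (f : R -> 'rV[R]_n) : 'rV[R]_n :=
  \row_(i < n) oint a b (fun s => f s 0 i).

(* The function $q \mapsto <x,q> - \sigma^*(q) - \int_0^t H(\tau,q) d\tau$;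
   its values lie in [-oo, +oo[ since sigma^* > -oo. *)
Definition hopf_arg (R : realType) (n : nat) (sigma : 'rV[R]_n -> R)
    (H : R -> 'rV[R]_n -> R) (t : R) (x q : 'rV[R]_n) : \bar R :=
  ((dot x q)%:E - fenchel sigma q - (oint 0 t (fun s => H s q))%:E)%E.

Definition is_max_on (R : realType) (n : nat) (A : set 'rV[R]_n)
    (f : 'rV[R]_n -> \bar R) (m : \bar R) : Prop :=
  (exists2 q, A q & f q = m) /\ (forall q, A q -> (f q <= m)%E).

Definition ell (R : realType) (n : nat) (sigma : 'rV[R]_n -> R)
    (H : R -> 'rV[R]_n -> R) (t : R) (x : 'rV[R]_n) : set 'rV[R]_n :=
  [set p | is_max_on setT (hopf_arg sigma H t x) (hopf_arg sigma H t x p)].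

Definition condA1 (R : realType) (n : nat) (T : R) (sigma : 'rV[R]_n -> R)
    (H : R -> 'rV[R]_n -> R) : Prop :=
  forall (t0 : R) (x0 : 'rV[R]_n), 0 <= t0 < T ->
  exists r N : R, [/\ 0 < r, 0 < N &
    forall (t : R) (x p : 'rV[R]_n), 0 <= t < T ->
      `|t - t0| + enorm (x - x0) < r -> N < enorm p ->
      exists2 m : \bar R,
        is_max_on [set q | enorm q <= N] (hopf_arg sigma H t x) m &
        (hopf_arg sigma H t x p < m)%E].

(* "g does not change its sign on (0, T)" is read as: the sign
   (-1, 0 or 1) of g is constant on (0, T). *)
Definition condA2 (R : realType) (n : nat) (T : R)
    (H : R -> 'rV[R]_n -> R) : Prop :=
  ((forall t : R, 0 < t < T -> convex_fun (H t)) \/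
   (forall t : R, 0 < t < T -> concave_fun (H t))) \/
  (exists (g : R -> R) (h : 'rV[R]_n -> R) (k : R -> R),
     (forall (t : R) (p : 'rV[R]_n), 0 <= t <= T -> H t p = g t * h p + k t) /\
     (forall s t : R, 0 < s < T -> 0 < t < T -> Num.sg (g s) = Num.sg (g t))).

Definition char_curve (R : realType) (n : nat) (sigma : 'rV[R]_n -> R)
    (H : R -> 'rV[R]_n -> R) (y : 'rV[R]_n) (t : R) : 'rV[R]_n :=
  y + oint_vec 0 t (fun s => gradient (H s) (gradient sigma y)).

Definition ell_star (R : realType) (n : nat) (sigma : 'rV[R]_n -> R)
    (H : R -> 'rV[R]_n -> R) (t0 : R) (x0 : 'rV[R]_n) : set 'rV[R]_n :=
  [set y | char_curve sigma H y t0 = x0].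

(* Main.v *)
(** Put e(s) = <H_p(s,p0), q - p0> - (H(s,q) - H(s,p0)). Along the curve
    starting at y, the difference D(t) of the maximized function at q and at p0
    equals D(0) + int_0^t e. Since sigma is differentiable at y, p0 is the only
    q with <y,q> - sigma^*(q) = sigma(y), so D(0) < 0 for q <> p0; and
    D(t0) <= 0 because p0 is in l(t0,x0). By (A2), either e <= 0 on (0,T),
    whence D(t) <= D(0) < 0, or e > 0 almost everywhere, whence
    D(t) < D(t0) <= 0. *)
Require Import Defs.
From mathcomp Require Import ring lra.

Set Implicit Arguments.
Unset Strict Implicit.
Unset Printing Implicit Defensive.

Import Order.TTheory GRing.Theory Num.Theory.
Import numFieldNormedType.Exports.

Local Open Scope classical_set_scope.
Local Open Scope ring_scope.

(** * Bilinearity of the Euclidean inner product *)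

Section dot.
Context (R : realType) (n : nat).
Implicit Types x y z : 'rV[R]_n.

Lemma dotC x y : dot x y = dot y x.
Proof. by apply: eq_bigr => i _; rewrite mulrC. Qed.

Lemma dotDl x y z : dot (x + y) z = dot x z + dot y z.
Proof. by rewrite -big_split; apply: eq_bigr => i _; rewrite mxE mulrDl. Qed.

Lemma dotBr x y z : dot x (y - z) = dot x y - dot x z.
Proof. by rewrite -sumrB; apply: eq_bigr => i _; rewrite !mxE mulrBr. Qed.

Lemma dot_delta x i : dot (delta_mx 0 i) x = x 0 i.
Proof.
rewrite /dot (bigD1 i)//= big1 ?addr0 => [|j ji].
  by rewrite mxE !eqxx mul1r.
by rewrite mxE (negbTE ji) andbF mul0r.
Qed.

End dot.

(** * Directional derivatives and tangent inequalities for convex functions *)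

Section directional_derivative.
Context (R : realType) (n : nat).
Implicit Types (f : 'rV[R]_n -> R) (x v : 'rV[R]_n).

Lemma dot_gradient f x v : differentiable f x ->
  dot (gradient f x) v = 'D_v f x.
Proof.
move=> df; rewrite deriveE// [in RHS](row_sum_delta v) linear_sum.
by apply: eq_bigr => i _; rewrite linearZ mxE deriveE// mulrC.
Qed.

(** The two-sided limit of the difference quotients is also their limit from the right, where
    dividing by [h > 0] keeps the inequality. *)
Lemma derive_le f x v c : derivable f x v ->
  (forall h, 0 < h < 1 -> f (h *: v + x) - f x <= h * c) -> 'D_v f x <= c.
Proof.
move=> dfv fc; apply: (cvgr_to_le (cvg_dnbhs_at_right dfv)).
near=> h.
have h01 : 0 < h < 1 by apply/andP; split; near: h;
  [exact: nbhs_right_gt | exact: nbhs_right_lt].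
by rewrite /= -[_ *: _]/(_ * _) ler_pdivrMl; [exact: fc|case/andP: h01].
Unshelve. all: by end_near. Qed.

Lemma derive_ge f x v c : differentiable f x ->
  (forall h, 0 < h < 1 -> h * c <= f (h *: v + x) - f x) -> c <= 'D_v f x.
Proof.
move=> df fc; rewrite -lerN2 -deriveN; last exact: diff_derivable.
apply: derive_le => [|h /fc ch].
  by apply: derivableN; exact: diff_derivable.
by change (- f (h *: v + x) - - f x <= h * - c); lra.
Qed.

Lemma convex_secant f p q a : convex_fun f -> 0 < a < 1 ->
  f (a *: q + (1 - a) *: p) <= a * f q + (1 - a) * f p.
Proof.
move=> cf /andP[a0 a1].
exact: (cf (Itv01 (ltW a0) (ltW a1)) q p (in_setT _) (in_setT _)).
Qed.

(** On the segment from [p] to [q], convexity bounds every difference quotient at [p] by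
    [f q - f p]; the bound passes to the limit. *)
Lemma convex_derive_le f p q : convex_fun f -> differentiable f p ->
  'D_(q - p) f p <= f q - f p.
Proof.
move=> cf df; apply: derive_le; first exact: diff_derivable.
move=> h h01; have := convex_secant p q cf h01.
rewrite (_ : h *: q + _ = h *: (q - p) + p); first lra.
by rewrite scalerBl scale1r scalerBr addrCA addrC.
Qed.

(** A limit loses strictness, so the tangent inequality is applied at the midpoint [m] of [p] and
    [q], and strict concavity puts [f m] above the mean of [f p] and [f q]. *)
Lemma strictly_concave_derive_gt f p q : concave_fun f ->
  strictly_concave_fun f -> differentiable f p -> q != p ->
  f q - f p < 'D_(q - p) f p.
Proof.
move=> cf scf df qp.
have h01 : 0 < (2^-1 : R) < 1 by lra.
have := scf q p _ qp h01.
set m := _ *: q + _.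
have mE : m - p = 2^-1 *: (q - p).
  by rewrite /m scalerBl scale1r scalerBr addrCA addrAC subrr add0r.
have dNf : differentiable (- f) p by exact: differentiableN.
have := convex_derive_le m cf dNf.
rewrite deriveN; last exact: diff_derivable.
have -> : 'D_(m - p) f p = 2^-1 * 'D_(q - p) f p.
  by rewrite mE !deriveE// linearZ.
change (- (2^-1 * 'D_(q - p) f p) <= - f m - - f p ->
  2^-1 * f q + (1 - 2^-1) * f p < f m -> f q - f p < 'D_(q - p) f p); lra.
Qed.

End directional_derivative.

(** * The Fenchel-Young inequality and its equality case *)

Section fenchel.
Context (R : realType) (n : nat) (sigma : 'rV[R]_n -> R).
Implicit Types y q : 'rV[R]_n.

Lemma fenchel_ge y q : ((dot y q - sigma y)%:E <= fenchel sigma q)%E.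
Proof. by apply: ereal_sup_ubound; exists y. Qed.

(** The tangent plane at [y] lies below [sigma], so the supremum defining the conjugate at the
    gradient is attained at [y]. *)
Lemma fenchel_gradient y : convex_fun sigma -> differentiable sigma y ->
  fenchel sigma (gradient sigma y) = (dot y (gradient sigma y) - sigma y)%:E.
Proof.
move=> cs ds; apply/eqP; rewrite eq_le fenchel_ge andbT.
apply: ub_ereal_sup => _ [z _ <-]; rewrite lee_fin.
have := convex_derive_le z cs ds.
rewrite -dot_gradient// dotBr !(dotC (gradient _ _)); lra.
Qed.

(** Equality in Fenchel-Young makes [q] a subgradient of [sigma] at [y]. Comparing it with the
    derivative along each basis vector and its opposite identifies it with the gradient. *)
Lemma fenchel_eq_gradient y q : differentiable sigma y ->
  fenchel sigma q = (dot y q - sigma y)%:E -> q = gradient sigma y.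
Proof.
move=> ds sE.
have subg v : dot q v <= 'D_v sigma y.
  apply: derive_ge => // h _; have := fenchel_ge (h *: v + y) q.
  rewrite sE lee_fin dotDl.
  have -> : dot (h *: v) q = h * dot q v.
    by rewrite /dot mulr_sumr; apply: eq_bigr => i _; rewrite mxE; ring.
  lra.
apply/rowP => i; apply/eqP; rewrite eq_le.
have dot_deltar x : dot x (delta_mx 0 i) = x 0 i by rewrite dotC dot_delta.
have := subg (delta_mx 0 i); rewrite -dot_gradient// !dot_deltar => -> /=.
have := subg (- delta_mx 0 i).
rewrite -dot_gradient// -sub0r !dotBr !dot_deltar.
have dot0 x : dot x 0 = 0 by rewrite /dot big1// => j _; rewrite mxE mulr0.
by rewrite !dot0; lra.
Qed.

End fenchel.

(** * Additivity and sign of oriented integrals *)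

Section oriented_integral.
Context (R : realType).
Notation mu := (@lebesgue_measure R).
Implicit Types (f g : R -> R) (a b c t T : R).

Lemma continuous_itv_integrable T a b f : {within `[0, T], continuous f} ->
  0 <= a -> b <= T -> mu.-integrable `[a, b] (EFin \o f).
Proof.
move=> cf a0 bT; apply: continuous_compact_integrable.
  exact: segment_compact.
by apply: continuous_subspaceW cf; apply: subset_itv; rewrite bnd_simp.
Qed.

Lemma oint_chain f a b : 0 <= a <= b -> mu.-integrable `[0, b] (EFin \o f) ->
  oint 0 b f - oint 0 a f = \int[mu]_(s in `]a, b]) f s.
Proof.
move=> /andP[a0 ab] intf; rewrite /oint a0 (le_trans a0 ab).
by rewrite Rintegral_itvB// bnd_simp.
Qed.

Lemma oint_rev f a b : 0 <= a < b -> mu.-integrable `[0, b] (EFin \o f) ->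
  oint b a f = oint 0 a f - oint 0 b f.
Proof.
move=> /andP[a0 ab] intf; rewrite -opprB oint_chain ?a0 ?ltW//.
rewrite /oint leNgt ab /= Rintegral_itv_obnd_cbnd//.
by apply: integrableS intf => //; apply: subset_itv; rewrite bnd_simp.
Qed.

Lemma oint_le0 f T t : 0 <= t < T -> mu.-integrable `[0, t] (EFin \o f) ->
  (forall s, 0 < s < T -> f s <= 0) -> oint 0 t f <= 0.
Proof.
move=> /andP[t0 tT] intf f0.
(* The sign of [f] is known only on the open interval, so the endpoint [0], a null set, is removed
   first. *)
rewrite /oint t0 -Rintegral_itv_obnd_cbnd; last first.
  by apply: integrableS intf => //; exact: subset_itv_oc_cc.
rewrite -oppr_ge0 -mulN1r -RintegralZl//; last first.
  by apply: integrableS intf => //; exact: subset_itv_oc_cc.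
apply: Rintegral_ge0 => s /=; rewrite in_itv/= => /andP[s0 st].
by rewrite mulN1r oppr_ge0 f0// s0 (le_lt_trans st).
Qed.

(** If the two integrals agreed, the nonnegative [f] would vanish almost everywhere on []a, b]].
    Being also positive almost everywhere there, it would make this interval negligible, although
    its measure is [b - a > 0]. *)
Lemma oint_lt f T a b : 0 <= a -> a < b -> b < T ->
  mu.-integrable `[0, b] (EFin \o f) ->
  (forall s, 0 < s < T -> 0 <= f s) ->
  {ae mu, forall s, 0 < s < T -> 0 < f s} ->
  oint 0 a f < oint 0 b f.
Proof.
move=> a0 ab bT intf f0 aef.
have intab : mu.-integrable `]a, b] (EFin \o f).
  by apply: integrableS intf => //; apply: subset_itv; rewrite bnd_simp.
have inT s : s \in `]a, b] -> 0 < s < T.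
  rewrite in_itv/= => /andP[as_ sb].
  by rewrite (le_lt_trans a0)// (le_lt_trans sb).
have fab0 s : `]a, b]%classic s -> 0 <= f s by move=> /= /inT /f0.
rewrite -subr_gt0 oint_chain ?a0 ?ltW// lt_neqAle Rintegral_ge0// andbT.
apply/negP => /eqP I0.
have : (\int[mu]_(s in `]a, b]) `|(EFin \o f) s| = 0)%E.
  (* [fine] sends infinite values to 0, so the vanishing of the real integral is informative only
     once the extended one is known to be finite. *)
  rewrite -[LHS]fineK; last first.
    by rewrite ge0_fin_numE ?integral_ge0//; case/integrableP: intab.
  congr EFin; rewrite [RHS]I0; congr fine.
  apply: eq_integral => s /set_mem /fab0 fs0.
  by rewrite /= ger0_norm.
move/ae_eq_integral_abs.
move=> /(_ (measurable_itv _) (measurable_int _ intab)) f_eq0.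
have : mu.-negligible `]a, b].
  apply: negligibleS (_ : {ae mu, forall s, ~ `]a, b]%classic s}).
    by move=> s sab /(_ sab).
  have Fae : Filter (nbhs (almost_everywhere mu)).
    exact: ae_filter_ringOfSetsType.
  apply: filterS2 aef f_eq0 => s fs_gt0 fs0 sab.
  by have [fs] := fs0 sab; have := fs_gt0 (inT _ sab); rewrite fs ltxx.
move/measure_negligible => /(_ (measurable_itv _)); apply/eqP.
change (mu `]a, b] != 0)%E.
by rewrite lebesgue_measure_itv/= lte_fin ab -EFinB eqe subr_eq0 gt_eqF.
Qed.

End oriented_integral.

(** * Time slices of functions on the strip, and integrals of vector-valued functions *)

Section strip.
Context (R : realType) (n : nat) (T : R).

(** The slice is the composite of [G] with [s |-> (s, p)], which is continuous and maps [[0, T]]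
    into the strip. *)
Lemma slice_continuous (W : topologicalType) (G : R -> 'rV[R]_n -> W) p :
  {within [set z : R * 'rV[R]_n | 0 <= z.1 <= T],
    continuous (fun z => G z.1 z.2)} ->
  {within `[0, T], continuous (fun s => G s p)}.
Proof.
move=> cG; apply/subspace_continuousP => s sT.
have /subspace_continuousP/(_ (s, p)) /= G_s := cG.
have sT' : 0 <= s <= T by move: sT; rewrite /= in_itv.
apply: (@cvg_comp _ _ _ (fun s' => (s', p)) (fun z => G z.1 z.2) _
  (within [set z : R * 'rV[R]_n | 0 <= z.1 <= T] (nbhs (s, p))));
  last exact: G_s.
move=> P; rewrite /within /= => PnearP.
have pairc : (s', p) @[s' --> s] --> (s, p).
  exact: (cvg_pair (@cvg_id _ (nbhs s)) (cvg_cst p)).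
change (\forall s' \near s, `[0, T]%classic s' -> P (s', p)).
have sP : \forall s' \near s, 0 <= s' <= T -> P (s', p) := pairc _ PnearP.
by near=> s'; rewrite /= in_itv; near: s'.
Unshelve. all: by end_near. Qed.

Lemma dot_continuous (f : R -> 'rV[R]_n) v (A : set R) :
  {within A, continuous f} -> {within A, continuous (fun s => dot (f s) v)}.
Proof.
move=> cf.
have dotc : continuous (fun u : 'rV[R]_n => \sum_i u 0 i * v 0 i).
  apply: continuous_big => [|i _]; first exact: add_continuous.
  move=> u; have ui : (fun w : 'rV[R]_n => w 0 i) @ u --> u 0 i.
    exact: coord_continuous.
  exact: (cvgMl ui).
by apply: (@within_continuous_comp _ _ _ A f
  (fun u => \sum_i u 0 i * v 0 i)) => // u _.
Qed.

Lemma coord_within_continuous (f : R -> 'rV[R]_n) i (A : set R) :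
  {within A, continuous f} -> {within A, continuous (fun s => f s 0 i)}.
Proof.
move=> cf.
apply: (@within_continuous_comp _ _ _ A f (fun u => u 0 i)) => // u _.
exact: coord_continuous.
Qed.

Lemma dot_oint_vec (f : R -> 'rV[R]_n) v t : 0 <= t <= T ->
  {within `[0, T], continuous f} ->
  dot (oint_vec 0 t f) v = oint 0 t (fun s => dot (f s) v).
Proof.
move=> /andP[t0 tT] cf; rewrite /dot.
under eq_bigr do rewrite mxE.
have intf i : (@lebesgue_measure R).-integrable `[0, t]
    (EFin \o (fun s => f s 0 i)).
  apply: (@continuous_itv_integrable _ T) => //.
  exact: coord_within_continuous.
rewrite /oint t0; under eq_bigr do rewrite -RintegralZr//.
have intfv i : (@lebesgue_measure R).-integrable `[0, t]
    (fun s => (f s 0 i * v 0 i)%:E).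
  exact: integrableZr (intf i).
rewrite /Rintegral sum_fine => [|i _]; last exact: integrable_fin_num.
congr fine; rewrite -integral_sum//.
by apply: eq_integral => s _; rewrite sumEFin.
Qed.

End strip.

(** * The gap between the tangent of [H s] at a point and [H s] itself *)

Section excess.
Context (R : realType) (n : nat) (T : R) (H : R -> 'rV[R]_n -> R).
Hypothesis H_C1 : C1_strip T H.
Notation mu := (@lebesgue_measure R).
Implicit Types (p q : 'rV[R]_n) (s t : R).

(** Minus the Bregman divergence of [H s]; for [p = p0] it is the function e above. *)
Definition excess p q s : R := 'D_(q - p) (H s) p - (H s q - H s p).

Let H_diff s p : 0 <= s <= T -> differentiable (H s) p.
Proof. by case: H_C1 => _ _ + _; exact. Qed.

Lemma integrable_slice p t : t <= T -> mu.-integrable `[0, t] (EFin \o (H^~ p)).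
Proof.
move=> tT; case: H_C1 => cH _ _ _.
apply: (@continuous_itv_integrable _ T) => //.
exact: (@slice_continuous _ _ _ _ H p cH).
Qed.

Lemma continuous_gradient_slice p :
  {within `[0, T], continuous (fun s => gradient (H s) p)}.
Proof.
case: H_C1 => _ _ _ cG.
exact: (@slice_continuous _ _ _ _ (fun s => gradient (H s)) p cG).
Qed.

Lemma integrable_gradient_slice p v t : t <= T ->
  mu.-integrable `[0, t] (EFin \o (fun s => dot (gradient (H s) p) v)).
Proof.
move=> tT; apply: (@continuous_itv_integrable _ T) => //.
exact/dot_continuous/continuous_gradient_slice.
Qed.

Let excessE p q s : 0 <= s <= T ->
  excess p q s = dot (gradient (H s) p) (q - p) - (H s q - H s p).
Proof. by move=> sT; rewrite dot_gradient//; exact: H_diff. Qed.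

Lemma integrable_excess p q t : t <= T ->
  mu.-integrable `[0, t] (EFin \o excess p q).
Proof.
move=> tT.
have intE : mu.-integrable `[0, t] (fun s =>
    ((dot (gradient (H s) p) (q - p))%:E - ((H s q)%:E - (H s p)%:E))%E).
  apply: integrableB => //; first exact: integrable_gradient_slice.
  by apply: integrableB => //; exact: integrable_slice.
apply: eq_integrable intE => // s /set_mem /=; rewrite in_itv/= => /andP[s0 st].
by rewrite excessE// s0 (le_trans st).
Qed.

(** Linearity of the integral. The first term on the right is the displacement of the characteristic
    curve with parameter [p], paired with [q - p]. *)
Lemma oint_excess p q t : 0 <= t <= T ->
  oint 0 t (excess p q) =
  dot (oint_vec 0 t (fun s => gradient (H s) p)) (q - p)
  - (oint 0 t (H^~ q) - oint 0 t (H^~ p)).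
Proof.
move=> tT; rewrite (dot_oint_vec _ tT)//; last exact: continuous_gradient_slice.
move/andP: tT => [t0 tT]; rewrite /oint t0.
rewrite -RintegralB//; try exact: integrable_slice.
rewrite -RintegralB//; last 2 first.
- exact: integrable_gradient_slice.
- have : mu.-integrable `[0, t] (fun s => ((H s q)%:E - (H s p)%:E)%E).
    by apply: integrableB => //; exact: integrable_slice.
  exact.
apply: eq_Rintegral => s /set_mem /=; rewrite in_itv/= => /andP[s0 st].
by rewrite excessE// s0 (le_trans st).
Qed.

Lemma excess_convex_le0 p q s : 0 <= s <= T -> convex_fun (H s) ->
  excess p q s <= 0.
Proof.
by move=> sT cH; rewrite subr_le0 convex_derive_le//; exact: H_diff.
Qed.

Lemma excess_concave_gt0 p q s : 0 <= s <= T -> q != p ->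
  concave_fun (H s) -> strictly_concave_fun (H s) -> 0 < excess p q s.
Proof.
move=> sT qp cH scH; rewrite subr_gt0 strictly_concave_derive_gt//.
exact: H_diff.
Qed.

Lemma excess_concave_ge0 p q s : 0 <= s <= T ->
  concave_fun (H s) -> 0 <= excess p q s.
Proof.
move=> sT cH; have dH := H_diff p sT.
have := convex_derive_le q cH (differentiableN dH).
rewrite [X in X <= _]deriveN; last exact: diff_derivable.
change (- 'D_(q - p) (H s) p <= - H s q - - H s p -> 0 <= excess p q s).
by rewrite /excess; lra.
Qed.

(* The combination [g t H s - g s H t] does not depend on [p], so no
   differentiability of [h] is needed. *)
Lemma excess_separable (g : R -> R) (h : 'rV[R]_n -> R) (k : R -> R) p q s t :
  (forall t p, 0 <= t <= T -> H t p = g t * h p + k t) ->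
  0 <= s <= T -> 0 <= t <= T -> g t * excess p q s = g s * excess p q t.
Proof.
move=> HE sT tT; rewrite /excess.
have dHs := H_diff p sT; have dHt := H_diff p tT.
have : 'D_(q - p) (g t \*: H s - g s \*: H t) p = 0.
  rewrite (_ : _ - _ = cst (g t * k s - g s * k t)) ?derive_cst//.
  apply/funext => z.
  change (g t * H s z - g s * H t z = g t * k s - g s * k t).
  by rewrite !HE//; ring.
rewrite deriveB; last 2 first.
- by apply: derivableZ; exact: diff_derivable.
- by apply: derivableZ; exact: diff_derivable.
rewrite !deriveZ; try exact: diff_derivable.
rewrite -![_ *: _]/(_ * _) /= !HE// => /eqP; rewrite subr_eq0 => /eqP DE.
by rewrite !mulrBr DE; ring.
Qed.

(** The convex form gives the first alternative and the concave form the second. In the separable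
    form all values of the excess are proportional with factors of one sign, so a single positive
    value forces positivity throughout. *)
Lemma excess_sign p q : condA2 T H -> q != p ->
  ((forall t, 0 < t < T -> concave_fun (H t)) ->
     {ae mu, forall t, 0 < t < T -> strictly_concave_fun (H t)}) ->
  (forall s, 0 < s < T -> excess p q s <= 0) \/
  ((forall s, 0 < s < T -> 0 <= excess p q s) /\
   {ae mu, forall s, 0 < s < T -> 0 < excess p q s}).
Proof.
have oc s : 0 < s < T -> 0 <= s <= T by move=> /andP[? ?]; rewrite !ltW.
move=> [[cH _|cH]|[g [h [k [HE gsgn]]]]] qp.
- by left => s sT; apply: excess_convex_le0; [exact: oc|exact: cH].
- move=> /(_ cH) scH; right; split=> [s sT|].
    by apply: excess_concave_ge0; [exact: oc|exact: cH].
  have Fae : Filter (nbhs (almost_everywhere mu)).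
    exact: ae_filter_ringOfSetsType.
  apply: filterS scH => s scH sT.
  by apply: excess_concave_gt0 => //; [exact: oc|exact: cH|exact: scH].
move=> _.
have [[s0 [s0T e0]]|/forallNP e_le0] :=
    pselect (exists s, 0 < s < T /\ 0 < excess p q s); last first.
  by left => s sT; rewrite leNgt; apply/negP => e_gt0; exact: (e_le0 s).
right.
have e_gt0 s : 0 < s < T -> 0 < excess p q s.
  move=> sT; have := excess_separable p q HE (oc _ s0T) (oc _ sT).
  move/(congr1 Num.sg); rewrite !sgrM (gsgn _ _ sT s0T) (gtr0_sg e0) mulr1.
  (* If [g s0] were zero, [H s0] would be constant and the excess at [s0] would vanish. *)
  have gs0 : Num.sg (g s0) != 0.
    rewrite sgr_eq0; apply/eqP => gs0; move: e0; rewrite /excess.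
    have Hk : H s0 = cst (k s0).
      by apply/funext => z; rewrite HE ?gs0 ?mul0r ?add0r//; exact: oc.
    by rewrite Hk derive_cst !subrr ltxx.
  by rewrite -[LHS]mulr1 => /(mulfI gs0)/esym/eqP; rewrite sgr_cp0.
split=> [s sT|]; first exact/ltW/e_gt0.
exact/aeW.
Qed.

(** Running the curve forward from [y] to time [t0] and back to time [t] cancels the integral over
    [[t, t0]]; this passes from the base point [x0] to [y]. *)
Lemma oint_vec_chain p y t t0 : 0 <= t < t0 -> t0 <= T ->
  y + oint_vec 0 t0 (fun s => gradient (H s) p) +
    oint_vec t0 t (fun s => gradient (H s) p) =
  y + oint_vec 0 t (fun s => gradient (H s) p).
Proof.
move=> tt0 t0T; rewrite -addrA; congr (_ + _); apply/rowP => i; rewrite !mxE.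
have intG : mu.-integrable `[0, t0] (EFin \o (fun s => gradient (H s) p 0 i)).
  apply: (@continuous_itv_integrable _ T) => //.
  exact/coord_within_continuous/continuous_gradient_slice.
by rewrite (oint_rev tt0 intG) addrC subrK.
Qed.

(** The added real number is D(t), and its part outside [oint] is D(0). Finite conjugates at [p] and
    [q] keep the computation in the reals. *)
Lemma hopf_arg_char (sigma : 'rV[R]_n -> R) y p q t (sp sq : R) :
  0 <= t <= T -> fenchel sigma p = sp%:E -> fenchel sigma q = sq%:E ->
  let x := y + oint_vec 0 t (fun s => gradient (H s) p) in
  hopf_arg sigma H t x q = (hopf_arg sigma H t x p +
    (dot y (q - p) - (sq - sp) + oint 0 t (excess p q))%:E)%E.
Proof.
move=> tT spE sqE x; rewrite /hopf_arg spE sqE -!EFinB -EFinD; congr EFin.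
rewrite oint_excess// !dotBr !dotDl /=; lra.
Qed.

End excess.

(** * Uniqueness of the maximizer along the curve before time [t0] *)

Theorem theorem2p10 (R : realType) (n : nat) (T : R)
    (H : R -> 'rV[R]_n -> R) (sigma : 'rV[R]_n -> R)
    (T_gt0 : 0 < T)
    (H_C1 : C1_strip T H)
    (sigma_convex : convex_fun sigma)
    (sigma_C1 : C1 sigma)
    (A1 : condA1 T sigma H)
    (A2 : condA2 T H)
    (H_strict : (forall t : R, 0 < t < T -> concave_fun (H t)) ->
       {ae (@lebesgue_measure R), forall t : R,
          0 < t < T -> strictly_concave_fun (H t)})
    (t0 : R) (x0 y p0 : 'rV[R]_n)
    (t0_in : 0 < t0 < T)
    (y_star : ell_star sigma H t0 x0 y)
    (p0E : p0 = gradient sigma y)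
    (p0_ell : ell sigma H t0 x0 p0) :
  forall (t : R) (x : 'rV[R]_n), 0 <= t < t0 ->
    x = x0 + oint_vec t0 t (fun s => gradient (H s) p0) ->
    ell sigma H t x = [set p0].
Proof.
move=> t x tt0 xE; have /andP[t_ge0 t_lt] := tt0.
have /andP[t0_gt0 t0T] := t0_in.
have dsigma : differentiable sigma y by case: sigma_C1.
have fp0 : fenchel sigma p0 = (dot y p0 - sigma y)%:E.
  by rewrite p0E fenchel_gradient.
have x0E : x0 = y + oint_vec 0 t0 (fun s => gradient (H s) p0).
  by rewrite p0E; symmetry; exact: y_star.
have {}xE : x = y + oint_vec 0 t (fun s => gradient (H s) p0).
  by rewrite xE x0E (oint_vec_chain H_C1)// ltW.
have tT : 0 <= t <= T by rewrite t_ge0 (le_trans (ltW t_lt))// ltW.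
have t0T' : 0 <= t0 <= T by rewrite !ltW.
have p0_max q : q != p0 -> (hopf_arg sigma H t x q < hopf_arg sigma H t x p0)%E.
  move=> qp0; have := fenchel_ge sigma y q.
  (* Fenchel-Young excludes the value [-oo]; at [+oo] the maximized function is [-oo] at [q] but
     finite at [p0]. *)
  case fq : (fenchel sigma q) => [sq| |] //=; last first.
    by move=> _; rewrite /hopf_arg fq fp0 /= -!EFinB ltNyr.
  (* Equality would force [q = p0]; the strict case [sq_gt] says D(0) < 0. *)
  rewrite lee_fin le_eqVlt => /predU1P[sqE|sq_gt].
    have qE : q = p0.
      by rewrite p0E; apply: (fenchel_eq_gradient dsigma); rewrite fq sqE.
    by rewrite qE eqxx in qp0.
  (* Maximality of [p0] at the point reached at time [t0] becomes D(t0) <= 0, and the goal becomes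
     D(t) < 0. *)
  have := p0_ell.2 q I; rewrite x0E (hopf_arg_char H_C1 y t0T' fp0 fq).
  rewrite xE (hopf_arg_char H_C1 y tT fp0 fq).
  rewrite /hopf_arg fp0 -!EFinB -!EFinD lee_fin lte_fin gerDl gtrDl dotBr.
  case: (excess_sign H_C1 A2 qp0 H_strict) => [e_le0|[e_ge0 e_gt0]] D_t0.
    have : oint 0 t (excess H p0 q) <= 0.
      apply: (oint_le0 (T := T)) => //; first by rewrite t_ge0 (lt_trans t_lt).
      by apply: (integrable_excess H_C1); have /andP[] := tT.
    lra.
  have : oint 0 t (excess H p0 q) < oint 0 t0 (excess H p0 q).
    apply: (oint_lt (T := T)) => //.
    exact: (integrable_excess H_C1 _ _ (ltW t0T)).
  lra.
apply/seteqP; split => [p [_ p_max]|_ ->]; last split=> [|q _].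
- apply/eqP/negP => /negP /p0_max.
  by rewrite ltNge p_max.
- by exists p0.
- by have [->//|/p0_max/ltW] := eqVneq q p0.
Qed.
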